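(* Let $E$ be a finite or countable set and let $H$ be a closed subspace of $\ell^2(E)$. Let $\mathfrak{B}$ be a random subset of $E$ with law $\mathbf{P}^H$. Then, $\mathbf{P}^H$-almost surely, the closed linear span of $P_H\mathfrak{B}=\{P_He : e\in\mathfrak{B}\}$ equals $H$.
   Context: $\ell^2(E)$ is the real or complex Hilbert space whose standard orthonormal basis is identified with $E$. For a closed subspace $H$, $P_H$ is the orthogonal projection onto $H$, and $\mathbf{P}^H$ is the unique Borel probability measure on $2^E$ such that a random set $\mathfrak{B}$ with law $\mathbf{P}^H$ satisfies $\mathbf{P}^H[A\subseteq\mathfrak{B}] = \det[(P_He,f)]_{e,f\in A}$ for all finite $A\subseteq E$ (such a measure exists). *)

(* Defs.v *)
From HB Require Import structures.
From mathcomp Require Import all_boot all_order all_algebra finmap complex.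
From mathcomp Require Import all_classical all_reals all_analysis.
From mathcomp Require Import ring lra.
From mathcomp Require analysis.showcase.summability.

Set Implicit Arguments.
Unset Strict Implicit.
Unset Printing Implicit Defensive.

Import Order.TTheory GRing.Theory Num.Theory.
Import numFieldNormedType.Exports.

Local Open Scope classical_set_scope.
Local Open Scope ring_scope.

(* Hilbert spaces are taken over R or R[i], selected by a [scalar_kind]. *)
Variant scalar_kind := RealScalars | ComplexScalars.

Section scalars.
Variable R : realType.

Definition scalar_field (k : scalar_kind) : numFieldType :=
  match k with RealScalars => R | ComplexScalars => R[i] end.

Definition of_real (k : scalar_kind) : R -> scalar_field k :=
  match k with
  | RealScalars => fun x => x
  | ComplexScalars => fun x => x%:C%C
  end.

Definition scalar_conj (k : scalar_kind) : scalar_field k -> scalar_field k :=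
  match k with
  | RealScalars => fun z => z
  | ComplexScalars => fun z => conjc z
  end.

Definition modulus (k : scalar_kind) : scalar_field k -> R :=
  match k with
  | RealScalars => fun z => `|z|
  | ComplexScalars => fun z => Normc.normc z
  end.

Variable k : scalar_kind.

Lemma modulusE (z : scalar_field k) : of_real k (modulus z) = `|z|.
Proof. by move: z; case: k. Qed.

Lemma modulus_ge0 (z : scalar_field k) : 0 <= modulus z.
Proof.
move: z; case: k => [z|[a b]] /=; first exact: normr_ge0.
exact: sqrtr_ge0.
Qed.

Lemma ler_modulusD (x y : scalar_field k) : modulus (x + y) <= modulus x + modulus y.
Proof.
move: x y; case: k => x y /=; [exact: ler_normD | exact: le_normcD].
Qed.

Lemma modulusM (x y : scalar_field k) : modulus (x * y) = modulus x * modulus y.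
Proof.
move: x y; case: k => x y /=; [exact: normrM | exact: Normc.normcM].
Qed.

Lemma modulus_eq0 (x : scalar_field k) : modulus x = 0 -> x = 0.
Proof.
move: x; case: k => x /=; [exact: normr0_eq0 | exact: Normc.eq0_normc].
Qed.

Lemma modulus0 : modulus (0 : scalar_field k) = 0.
Proof. by case: k => /=; [exact: normr0 | exact: Normc.normc0]. Qed.

Lemma modulus1 : modulus (1 : scalar_field k) = 1.
Proof. by case: k => /=; [exact: normr1 | exact: Normc.normc1]. Qed.

Lemma of_realD (x y : R) : of_real k (x + y) = of_real k x + of_real k y.
Proof. by case: k => //=; exact: rmorphD. Qed.

Lemma of_realM (x y : R) : of_real k (x * y) = of_real k x * of_real k y.
Proof. by case: k => //=; exact: rmorphM. Qed.

Lemma ler_of_real (x y : R) : (of_real k x <= of_real k y) = (x <= y).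
Proof. by case: k => //=; exact: lecR. Qed.

Lemma of_real_eq0 (x : R) : of_real k x = 0 -> x = 0.
Proof. by case: k => //= -[]. Qed.

End scalars.

Section square_summable.
Variables (R : realType) (k : scalar_kind) (E : choiceType).
Local Notation K := (scalar_field R k).
Implicit Types (x y : E -> K) (t : R).

Definition sqsum x : \bar R := (\esum_(e in [set: E]) (modulus (x e) ^+ 2)%:E)%E.

Definition square_summable : {pred E -> K} := [pred x | (sqsum x < +oo)%E].

Lemma sqsum_ge0 x : (0 <= sqsum x)%E.
Proof. by apply: esum_ge0 => e _; rewrite lee_fin sqr_ge0. Qed.

Lemma sqsumZ_le t (f : E -> R) : 0 <= t -> (forall e, 0 <= f e) ->
  (\esum_(e in [set: E]) (t * f e)%:E <= t%:E * \esum_(e in [set: E]) (f e)%:E)%E.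
Proof.
move=> t0 f0; apply: ge_ereal_sup => _ [A [finA _] <-].
under eq_fsbigr do rewrite EFinM.
rewrite -ge0_mule_fsumr; last by move=> e; rewrite lee_fin.
rewrite lee_wpmul2l ?lee_fin//; apply: ereal_sup_ubound; by exists A.
Qed.

Lemma sqsumD_le t x y : 0 < t ->
  (sqsum (x + y)%R <= (1 + t)%:E * sqsum x + (1 + t^-1)%:E * sqsum y)%E.
Proof.
move=> t0; have ti0 : 0 < t^-1 by rewrite invr_gt0.
have le1 u : 0 < u -> 0 <= 1 + u :> R by move=> u0; rewrite addr_ge0// ltW.
apply: (@le_trans _ _ (\esum_(e in [set: E])
   (((1 + t) * modulus (x e) ^+ 2)%:E + ((1 + t^-1) * modulus (y e) ^+ 2)%:E))%E).
  apply: le_esum => e _; rewrite -EFinD lee_fin.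
  set a := modulus (x e); set b := modulus (y e).
  apply: (@le_trans _ _ ((a + b) ^+ 2)).
    by rewrite ler_pXn2r ?nnegrE ?addr_ge0 ?modulus_ge0// ler_modulusD.
  rewrite -subr_ge0.
  suff -> : (1 + t) * a ^+ 2 + (1 + t^-1) * b ^+ 2 - (a + b) ^+ 2
      = t^-1 * (t * a - b) ^+ 2 by rewrite mulr_ge0 ?sqr_ge0// ltW.
  by field; rewrite gt_eqF.
rewrite esumD; last 2 first.
- by move=> e _; rewrite lee_fin mulr_ge0 ?sqr_ge0 ?le1.
- by move=> e _; rewrite lee_fin mulr_ge0 ?sqr_ge0 ?le1.
by apply: leeD; apply: sqsumZ_le; rewrite ?le1// => e; exact: sqr_ge0.
Qed.

Lemma sqsumZ (a : K) x : (sqsum (a *: x)%R <= (modulus a ^+ 2)%:E * sqsum x)%E.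
Proof.
rewrite /sqsum; under eq_esum => e _ do
  rewrite (_ : (a *: x) e = a * x e)// modulusM exprMn.
by apply: sqsumZ_le => [|e]; exact: sqr_ge0.
Qed.

Lemma sqsum0 : sqsum 0 = 0%E.
Proof. by apply: esum1 => e _; rewrite /= modulus0 expr0n. Qed.

Lemma square_summable_submod_closed : submod_closed square_summable.
Proof.
split=> [|a x y]; rewrite !inE ?sqsum0 ?ltry// => xfin yfin.
apply: (le_lt_trans (sqsumD_le _ _ ltr01)).
rewrite lte_add_pinfty// lte_mul_pinfty ?lee_fin ?addr_ge0 ?invr_ge0 ?sqsum_ge0//.
apply: (le_lt_trans (sqsumZ _ _)).
by rewrite lte_mul_pinfty ?lee_fin ?sqr_ge0.
Qed.

HB.instance Definition _ := GRing.isSubmodClosed.Build K (E -> K)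
  square_summable square_summable_submod_closed.

Record ell2 := Ell2 { ell2_fun :> E -> K; ell2P : ell2_fun \in square_summable }.

HB.instance Definition _ := [isSub for ell2_fun].
HB.instance Definition _ := [Choice of ell2 by <:].
HB.instance Definition _ := [SubChoice_isSubLmodule of ell2 by <:].

Definition l2norm (x : ell2) : R := Num.sqrt (fine (sqsum x)).

Lemma sqsum_l2norm (x : ell2) : sqsum x = (l2norm x ^+ 2)%:E.
Proof.
rewrite /l2norm sqr_sqrtr ?fine_ge0 ?sqsum_ge0// fineK// ge0_fin_numE ?sqsum_ge0//.
exact: ell2P x.
Qed.

Lemma l2norm_ge0 (x : ell2) : 0 <= l2norm x. Proof. exact: sqrtr_ge0. Qed.

Lemma l2norm_eq0 (x : ell2) : l2norm x = 0 -> x = 0.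
Proof.
move=> x0; apply/val_inj/funext => e /=; apply: modulus_eq0; apply/eqP.
rewrite -sqrf_eq0 eq_le sqr_ge0 andbT -lee_fin.
have := sqsum_l2norm x; rewrite x0 expr0n /= => <-.
apply: esum_ge; exists [set e]; first by split.
by rewrite fsbig_set1.
Qed.

Lemma ler_l2normD (x y : ell2) : l2norm (x + y) <= l2norm x + l2norm y.
Proof.
have := l2norm_ge0 x; rewrite le0r => /orP[/eqP x0|x0].
  by rewrite (l2norm_eq0 x0) add0r lerDr ?l2norm_ge0.
have := l2norm_ge0 y; rewrite le0r => /orP[/eqP y0|y0].
  by rewrite (l2norm_eq0 y0) addr0 lerDl ?l2norm_ge0.
rewrite -ler_sqr ?nnegrE ?addr_ge0 ?l2norm_ge0// -lee_fin -sqsum_l2norm.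
apply: (le_trans (@sqsumD_le (l2norm y / l2norm x) _ _ (divr_gt0 y0 x0))).
rewrite !sqsum_l2norm -!EFinM -EFinD lee_fin.
rewrite le_eqVlt; apply/orP; left; apply/eqP; field.
by rewrite !gt_eqF.
Qed.

Lemma l2normZ_le (a : K) (x : ell2) : l2norm (a *: x) <= modulus a * l2norm x.
Proof.
rewrite -ler_sqr ?nnegrE ?mulr_ge0 ?modulus_ge0 ?l2norm_ge0//.
by rewrite -lee_fin -sqsum_l2norm exprMn EFinM -sqsum_l2norm sqsumZ.
Qed.

Lemma l2normZ (a : K) (x : ell2) : l2norm (a *: x) = modulus a * l2norm x.
Proof.
apply/eqP; rewrite eq_le l2normZ_le /=.
have [->|a0] := eqVneq a 0; first by rewrite modulus0 mul0r l2norm_ge0.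
have ma0 : 0 < modulus a.
  rewrite lt_neqAle modulus_ge0 andbT eq_sym.
  by apply: contra a0 => /eqP/modulus_eq0/eqP.
have := l2normZ_le a^-1 (a *: x).
rewrite scalerA mulVf// scale1r => /(ler_wpM2l (modulus_ge0 a)).
by move=> /le_trans; apply; rewrite mulrA -modulusM mulfV// modulus1 mul1r.
Qed.

Lemma ler_ell2_normD (x y : ell2) :
  of_real k (l2norm (x + y)) <= of_real k (l2norm x) + of_real k (l2norm y).
Proof. by rewrite -of_realD ler_of_real ler_l2normD. Qed.

Lemma ell2_normZ (a : K) (x : ell2) :
  of_real k (l2norm (a *: x)) = `|a| * of_real k (l2norm x).
Proof. by rewrite l2normZ of_realM modulusE. Qed.

Lemma ell2_norm_eq0 (x : ell2) : of_real k (l2norm x) = 0 -> x = 0.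
Proof. by move=> /of_real_eq0/l2norm_eq0. Qed.

(* The norm of a [normedModType K] is [K]-valued. *)
HB.instance Definition _ :=
  Lmodule_isNormed.Build K ell2 ler_ell2_normD ell2_normZ ell2_norm_eq0.

End square_summable.

Section hilbert.
Variables (R : realType) (k : scalar_kind) (E : choiceType).
Local Notation K := (scalar_field R k).
Local Notation H2 := (ell2 R k E).

(* [summability.sum] is the limit of the finite partial sums along the filter of
   finite subsets of E; it converges for square-summable x and y. *)
Definition dotp (x y : H2) : K :=
  summability.sum (fun e : E => x e * scalar_conj (y e)).

Lemma delta_square_summable (e : E) :
  (fun f => (f == e)%:R) \in @square_summable R k E.
Proof.
rewrite inE /sqsum.
rewrite (@eq_esum _ _ _ _ (fun f => if f \in [set e] then 1%E else 0%E)).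
  by rewrite -esum_mkcond esum_set1 ?ltry.
move=> f _; rewrite classical_sets.in_set1; case: eqP => _.
  by rewrite modulus1 expr1n.
by rewrite modulus0 expr0n.
Qed.

Definition std_basis (e : E) : H2 := Ell2 (delta_square_summable e).

(* [get] returns the element of the set, which is a singleton when H is a closed
   subspace (projection theorem). *)
Definition orth_proj (H : set H2) (x : H2) : H2 :=
  get [set y | H y /\ forall z, H z -> dotp (x - y) z = 0].

End hilbert.

Definition lspan (K : pzRingType) (V : lmodType K) (S : set V) : set V :=
  [set x | exists (n : nat) (c : 'I_n -> K) (v : 'I_n -> V),
    (forall i, S (v i)) /\ x = \sum_(i < n) c i *: v i].

(* A subset of E is encoded by its indicator function, and 2^E carries the Borel
   sigma-algebra of the product topology. *)
Definition borel_powerset (E : Type) :=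
  g_sigma_algebraType (@open {ptws E -> bool}).

(* The matrix [(P_H e, f)]_(e, f in A), for the enumeration of A underlying the
   finite set A; its determinant does not depend on this enumeration. *)
Definition kernel_mx (R : realType) (k : scalar_kind) (E : choiceType)
    (H : set (ell2 R k E)) (A : {fset E}) : 'M[scalar_field R k]_(size A) :=
  \matrix_(i, j) dotp (orth_proj H (std_basis R k (tnth (in_tuple A) i)))
                      (std_basis R k (tnth (in_tuple A) j)).

(* [of_real] is needed because the determinant is an element of R or R[i]. *)
Definition determinantal_law (R : realType) (k : scalar_kind) (E : choiceType)
    (H : set (ell2 R k E)) (P : probability (borel_powerset E) R) : Prop :=
  forall A : {fset E},
    of_real k (fine (P [set B | forall e, e \in A -> B e])) = \det (kernel_mx H A).

(* Main.v *)
From HB Require Import structures.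
Require Import Defs.
From mathcomp Require Import all_boot all_order all_algebra finmap perm complex.
From mathcomp Require Import all_classical all_reals all_analysis.
From mathcomp Require Import ring lra.
From mathcomp Require analysis.showcase.summability.

(** Let [missing e] be the event that [e] is not in B although some [h] in [H]
    vanishes on B and has [h e = 1]. If no [missing e] occurs, then no nonzero
    element of [H] vanishes on B, and since [(P_H e, h)] is the conjugate of
    [h e] this says that the vectors [P_H e], [e] in B, are total in [H].

    To see that [missing e] is null, reveal B on a finite set S not containing
    [e], and suppose that some [h] in [H] vanishes on the part of B found so far,
    has [h e = 1], and carries mass at most [c] outside S and [e]. Then [e] is
    vacant with conditional probability at most [c]: conditioning replaces the
    kernel of [P_H] by Schur complements, and the hypothesis on [h] is carried
    through them as the inequality
      |<y, z>|^2 <= (|y|^2 + c) <Kz, z>   for all z,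
    which for one remaining site reads [1 <= (1 + c) K e e]. As S grows to E the
    tail of every [h] tends to 0, so [missing e] is contained in the lower limit
    of events of probability at most [c], for every [c > 0]. *)

Set Implicit Arguments.
Unset Strict Implicit.
Unset Printing Implicit Defensive.

Import Order.TTheory GRing.Theory Num.Theory.
Import numFieldNormedType.Exports.
Import summability.
Local Open Scope classical_set_scope.
Local Open Scope ring_scope.

(** * Minors and Schur complements *)

Section minors.
Variables (F : fieldType) (E : eqType).
Implicit Types (K : E -> E -> F) (s : seq E).

Definition minor K s : F :=
  \det (\matrix_(i < size s, j < size s)
    K (tnth (in_tuple s) i) (tnth (in_tuple s) j)).

(** The pivot [a] is left free: [K f f] gives the kernel conditioned on [f] being occupied,
    [K f f - 1] the kernel conditioned on [f] being vacant. *)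
Definition schur K (f : E) (a : F) (g h : E) : F :=
  K g h - a^-1 * (K g f * K f h).

Lemma det_bordered n (a : F) (r : 'rV[F]_n) (c : 'cV[F]_n) (M : 'M[F]_n) : a != 0 ->
  \det (block_mx a%:M r c M : 'M[F]_(1 + n)) = a * \det (M - a^-1 *: (c *m r)).
Proof.
move=> a0.
have -> : block_mx a%:M r c M = block_mx 1%:M 0 (a^-1 *: c) 1%:M *m
    block_mx a%:M r 0 (M - a^-1 *: (c *m r)).
  rewrite mulmx_block !mul1mx !mul0mx !addr0 -!scalemxAl.
  by rewrite mul_mx_scalar scalerA mulVf// scale1r addrC subrK.
by rewrite det_mulmx det_lblock det_ublock !det1 !mul1r det_scalar expr1.
Qed.

(** The determinant is affine in its corner entry, with the cofactor [\det M] as slope. This trades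
    a diagonal entry of the kernel for an arbitrary pivot. *)
Lemma det_borderedB n (a b : F) (r : 'rV[F]_n) (c : 'cV[F]_n) (M : 'M[F]_n) :
  \det (block_mx a%:M r c M : 'M[F]_(1 + n)) =
  \det (block_mx b%:M r c M : 'M[F]_(1 + n)) + (a - b) * \det M.
Proof.
have -> : \det M = \det (block_mx 1%:M 0 c M : 'M[F]_(1 + n)).
  by rewrite det_lblock det1 mul1r.
(* The first row [(a, r)] is [1 * (b, r) + (a - b) * (1, 0)]. *)
rewrite -[X in _ = X + _]mul1r.
apply: (@determinant_multilinear _ _ _ _ _ (lshift n ord0)).
- rewrite /block_mx !rowKu !row_id scale1r scale_row_mx add_row_mx scaler0 addr0.
  by rewrite scale_scalar_mx mulr1 -raddfD/= addrC subrK.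
- by apply/matrixP => i j; rewrite !mxE; case: splitP => [[[]]|] // k; rewrite !mxE.
- by apply/matrixP => i j; rewrite !mxE; case: splitP => [[[]]|] // k; rewrite !mxE.
Qed.

Lemma minor_cons K f s : minor K (f :: s) =
  \det (block_mx (K f f)%:M
     (\row_(j < size s) K f (tnth (in_tuple s) j))
     (\col_(i < size s) K (tnth (in_tuple s) i) f)
     (\matrix_(i < size s, j < size s)
        K (tnth (in_tuple s) i) (tnth (in_tuple s) j)) : 'M[F]_(1 + size s)).
Proof.
rewrite /minor; congr (\det _); apply/matrixP => i j; rewrite !mxE !(tnth_nth f) /=.
case: splitP => i' ->; rewrite !mxE;
  case: splitP => j' ->; rewrite !mxE ?(tnth_nth f)//=.
- by rewrite !ord1 eqxx mulr1n.
- by rewrite ord1.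
- by rewrite ord1.
Qed.

(** Elimination with pivot [a] evaluates the minor with corner [a], and the last term corrects the
    corner. For [a = K f f - 1] the right-hand side is [minor K (f :: s) - minor K s], the
    inclusion-exclusion formula for a vacant [f] up to sign. *)
Lemma minor_schur K f a s : a != 0 ->
  a * minor (schur K f a) s = minor K (f :: s) + (a - K f f) * minor K s.
Proof.
move=> a0; rewrite minor_cons -det_borderedB det_bordered//.
congr (_ * \det _); apply/matrixP => i j.
by rewrite !mxE big_ord1 !mxE.
Qed.

Lemma minor1 K f : minor K [:: f] = K f f.
Proof. by rewrite /minor [X in \det X]mx11_scalar det_scalar1 mxE. Qed.

Lemma perm_minor K s t : perm_eq s t -> minor K s = minor K t.
Proof.
move=> st.
have key n (u v : n.-tuple E) : perm_eq u v ->
    \det (\matrix_(i, j) K (tnth u i) (tnth u j)) =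
    \det (\matrix_(i, j) K (tnth v i) (tnth v j)).
  move=> /tuple_permP[p up].
  have -> : \matrix_(i, j) K (tnth u i) (tnth u j) =
     row_perm p (col_perm p (\matrix_(i, j) K (tnth v i) (tnth v j))).
    apply/matrixP => i j; rewrite !mxE.
    have {}up k : tnth u k = tnth v (p k).
      rewrite (tnth_nth (tnth v (p k))) up.
    by rewrite -(tnth_nth _ [tuple tnth v (p i0)  | i0 < n])/= tnth_mktuple.
    by rewrite !up.
  rewrite row_permE col_permE !det_mulmx !det_perm odd_permV.
  by rewrite mulrC -mulrA -signr_addb addbb mulr1.
have minorE n (v : n.-tuple E) : minor K v =
    \det (\matrix_(i, j) K (tnth v i) (tnth v j)).
  case: v => v vn; move/eqP: (vn) => vE; subst n; rewrite /minor.
  congr (\det _); apply/matrixP => i j; rewrite !mxE.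
  by have x0 : E := tnth (in_tuple v) i; rewrite !(tnth_nth x0).
have tP : size t == size s by rewrite (perm_size st).
by have := key _ (in_tuple s) (Tuple tP) st; rewrite -!minorE.
Qed.

End minors.

(** * Quadratic forms and the domination inequality *)

Section domination.
Variables (F : numFieldType) (cj : {rmorphism F -> F}).
Hypothesis normCE : forall z, `|z| ^+ 2 = z * cj z.
Hypothesis cjK : involutive cj.
Variable E : eqType.
Implicit Types (K : E -> E -> F) (S : seq E) (y z : E -> F).

Definition qform K S z : F :=
  \sum_(g <- S) \sum_(h <- S) z g * cj (z h) * K g h.

Definition pairing S y z : F := \sum_(g <- S) y g * cj (z g).

Definition sqn S y : F := \sum_(g <- S) `|y g| ^+ 2.

(* If [K] is the kernel of a projection [P_H] and [y] is the restriction to [S] of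
   an element [h] of [H], this holds as soon as [h] has mass at most [t] off [S],
   by the Cauchy-Schwarz inequality for [(h, P_H z)]. *)
Definition dominated K S y t : Prop :=
  forall z, `|pairing S y z| ^+ 2 <= (sqn S y + t) * qform K S z.

Definition hermitian_kernel K : Prop := forall g h, K h g = cj (K g h).

Lemma cj_ge0 x : 0 <= x -> cj x = x.
Proof.
move=> x0; have [->|xn0] := eqVneq x 0; first exact: rmorph0.
by apply: (mulfI xn0); rewrite -normCE ger0_norm.
Qed.

Lemma schur_hermitian K f a : cj a = a -> hermitian_kernel K ->
  hermitian_kernel (schur K f a).
Proof.
move=> aE hK g h; rewrite /schur rmorphB rmorphM fmorphV aE rmorphM -!hK.
by rewrite [K f g * _]mulrC.
Qed.

Lemma qform_cons K f S z : hermitian_kernel K ->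
  let a := \sum_(g <- S) z g * K g f in
  qform K (f :: S) z =
  z f * cj (z f) * K f f + z f * cj a + cj (z f) * a + qform K S z.
Proof.
move=> hK a; rewrite /qform big_cons big_cons.
have -> : \sum_(h <- S) z f * cj (z h) * K f h = z f * cj a.
  rewrite rmorph_sum mulr_sumr; apply: eq_bigr => h _.
  by rewrite rmorphM -hK mulrA.
rewrite -[RHS]addrA; congr (_ + _); rewrite mulr_sumr -big_split /=.
by apply: eq_bigr => g _; rewrite big_cons mulrCA mulrA.
Qed.

(** The linear form [a] is the cross term of [qform_cons], so the form on [f :: S] is compared with
    that of the Schur complement on [S] by completing the square in [z f]. *)
Lemma qform_schur K f b S z : hermitian_kernel K ->
  let a := \sum_(g <- S) z g * K g f in
  qform (schur K f b) S z = qform K S z - b^-1 * (a * cj a).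
Proof.
move=> hK a; rewrite /a rmorph_sum mulr_suml mulr_sumr /qform -sumrB.
apply: eq_bigr => g _; rewrite 2!mulr_sumr -sumrB; apply: eq_bigr => h _.
by rewrite rmorphM -hK /schur; ring.
Qed.

Definition upd z f c g : F := if g == f then c else z g.

Lemma updE z f c : upd z f c f = c. Proof. by rewrite /upd eqxx. Qed.

Lemma upd_sum S z f c (G : E -> F -> F) : f \notin S ->
  \sum_(g <- S) G g (upd z f c g) = \sum_(g <- S) G g (z g).
Proof.
move=> fS; apply: eq_big_seq => g gS; rewrite /upd.
by case: eqP gS fS => // -> ->.
Qed.

Lemma upd_qform K S z f c : f \notin S -> qform K S (upd z f c) = qform K S z.
Proof.
move=> fS; apply: eq_big_seq => g gS; rewrite {1}/upd.
case: eqP gS fS => [->->//|_ gS fS].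
by rewrite (upd_sum z c (fun h u => z g * cj u * K g h)).
Qed.

(** Since [y f = 0], the pairing does not see the value of a test vector at [f]. Minimizing the
    quadratic form over that value, at [- a / K f f], produces the Schur complement. *)
Lemma dominated_schur_in K f S y t : hermitian_kernel K -> f \notin S -> y f = 0 ->
  K f f != 0 -> dominated K (f :: S) y t ->
  dominated (schur K f (K f f)) S y t.
Proof.
move=> hK fS yf k0 dom z.
set a := \sum_(g <- S) z g * K g f.
have := dom (upd z f (- a / K f f)).
rewrite /pairing /sqn !big_cons yf mul0r add0r normr0 expr0n add0r.
rewrite (upd_sum z _ (fun g u => y g * cj u))//.
rewrite qform_cons// updE (upd_sum z _ (fun g u => u * K g f))// upd_qform//.
rewrite qform_schur// -/a.
have kR : cj (K f f) = K f f by rewrite -hK.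
congr (_ <= _ * _); rewrite rmorphM rmorphN fmorphV kR; field.
by [].
Qed.

(** Here [y f] is arbitrary. Since [K f f < 1], the form on [f :: S] is at most [Q + |c|^2], where
    [Q] is the form of the Schur complement and [c] the value at [f]; a suitable [c] then turns the
    hypothesis into [|X|^2 / N' <= Q]. *)
Lemma dominated_schur_out K f S y t : hermitian_kernel K -> f \notin S ->
  K f f < 1 -> 0 < sqn S y + t -> dominated K (f :: S) y t ->
  dominated (schur K f (K f f - 1)) S y t.
Proof.
move=> hK fS k1 N0 dom z.
set a := \sum_(g <- S) z g * K g f.
set N' := sqn S y + t in N0 *; set X := pairing S y z; set k := K f f in k1 *.
(* The value of the free coordinate [z f] for which the hypothesis is strongest. *)
set c := y f * cj X / N'.
have := dom (upd z f c).
rewrite /pairing /sqn !big_cons updE.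
rewrite (upd_sum z _ (fun g u => y g * cj u))// -/(pairing S y z) -/X.
rewrite qform_cons// updE (upd_sum z _ (fun g u => u * K g f))// upd_qform//.
rewrite qform_schur// -/a -/k -/(sqn S y) -addrA -/N' /=.
set q := qform K S z; set Q := q - (k - 1)^-1 * (a * cj a).
have kR : cj k = k by rewrite -hK.
have k1' : 0 < 1 - k by rewrite subr_gt0.
have N'R : cj N' = N' by rewrite cj_ge0// ltW.
have -> : c * cj c * k + c * cj a + cj c * a + q =
    Q + `|c| ^+ 2 - (1 - k) * `|c - a / (1 - k)| ^+ 2.
  rewrite /Q !normCE !rmorphB !rmorphM !fmorphV !rmorphB rmorph1 kR; field.
  by rewrite N'R gt_eqF//= gt_eqF//= subr_eq0 lt_eqF.
have -> : y f * cj c + X = X * (`|y f| ^+ 2 + N') / N'.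
  rewrite /c normCE !rmorphM fmorphV N'R cjK; field.
  by rewrite gt_eqF.
move=> le1.
have NN : 0 < `|y f| ^+ 2 + N' by rewrite ltr_wpDl// exprn_ge0.
have {le1} := le_trans le1 (ler_wpM2l (ltW NN) (_ : _ <= Q + `|c| ^+ 2)).
rewrite gerDl oppr_le0 => /(_ (mulr_ge0 (ltW k1') (exprn_ge0 _ (normr_ge0 _)))).
rewrite normf_div normrM !(gtr0_norm N0) !(gtr0_norm NN).
have -> : `|c| ^+ 2 = `|y f| ^+ 2 * `|X| ^+ 2 / N' ^+ 2.
  rewrite /c normf_div normrM (gtr0_norm N0) !exprMn -exprVn; congr (_ * _ * _).
  by rewrite normCE cjK mulrC -normCE.
set u := `|y f| ^+ 2 in NN *; set x := `|X|.
have -> : (x * (u + N') / N') ^+ 2 = (u + N') * (x ^+ 2 * (u + N') / N' ^+ 2).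
  by field; rewrite gt_eqF.
(* After the factor [u + N'] is cancelled, the contribution of [|c|^2] moves to the left and exactly
   removes the term in [u]. *)
rewrite ler_pM2l// -lerBlDr.
have -> : x ^+ 2 * (u + N') / N' ^+ 2 - u * x ^+ 2 / N' ^+ 2 = x ^+ 2 / N'.
  by field; rewrite gt_eqF.
by rewrite ler_pdivrMr// [Q * _]mulrC.
Qed.

End domination.

(** * Occupation events *)

Section scalars.
Variables (R : realType) (k : scalar_kind).
Local Notation K := (scalar_field R k).

Lemma of_real_is_monoid_morphism : monoid_morphism (@of_real R k).
Proof. by case: k => //; split=> // x y; exact: rmorphM. Qed.

Lemma of_real_is_zmod_morphism : zmod_morphism (@of_real R k).
Proof. by case: k => // x y; exact: rmorphB. Qed.

HB.instance Definition _ :=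
  GRing.isZmodMorphism.Build R K (@of_real R k) of_real_is_zmod_morphism.
HB.instance Definition _ :=
  GRing.isMonoidMorphism.Build R K (@of_real R k) of_real_is_monoid_morphism.

Lemma scalar_conj_is_monoid_morphism : monoid_morphism (@scalar_conj R k).
Proof. by case: k => //; split=> [|x y]; [exact: rmorph1 | exact: rmorphM]. Qed.

Lemma scalar_conj_is_zmod_morphism : zmod_morphism (@scalar_conj R k).
Proof. by case: k => // x y; exact: rmorphB. Qed.

HB.instance Definition _ :=
  GRing.isZmodMorphism.Build K K (@scalar_conj R k) scalar_conj_is_zmod_morphism.
HB.instance Definition _ :=
  GRing.isMonoidMorphism.Build K K (@scalar_conj R k) scalar_conj_is_monoid_morphism.

Lemma scalar_conjK : involutive (@scalar_conj R k).
Proof. by case: k => // x; exact: conjcK. Qed.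

Lemma scalar_normCE (z : K) : `|z| ^+ 2 = z * scalar_conj z.
Proof.
move: z; case: k => /= z; first by rewrite real_normK ?num_real// expr2.
by rewrite sqr_normc.
Qed.

Lemma ltr_of_real (x y : R) : (of_real k x < of_real k y) = (x < y).
Proof. by rewrite !lt_neqAle ler_of_real fmorph_eq. Qed.

End scalars.

Section occupation.
Variables (R : realType) (k : scalar_kind) (E : choiceType).
Variable P : probability (borel_powerset E) R.
Local Notation T := (borel_powerset E).
Local Notation F := (scalar_field R k).
Implicit Types (X Y : set T) (S s : seq E) (G : seq bool -> bool).

Definition occupied (e : E) : set T := [set B : T | B e].

Lemma measurable_occupied e : measurable (occupied e).
Proof.
apply: sub_sigma_algebra.
have op : open [set true] by exact: discrete_open.
apply: (@open_comp {ptws E -> bool} bool (fun B => B e) _ _ op) => B _.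
exact: (@proj_continuous E (fun=> bool : topologicalType) e).
Qed.

Lemma measurable_vacant e : measurable (~` occupied e).
Proof. by apply: measurableC; exact: measurable_occupied. Qed.

Definition all_occupied s : set T := [set B : T | all (fun e => B e) s].

Lemma all_occupied_cons e s : all_occupied (e :: s) = occupied e `&` all_occupied s.
Proof. by apply/seteqP; split=> B /=; [move/andP | move=> [? ?]; apply/andP]. Qed.

Lemma measurable_all_occupied s : measurable (all_occupied s).
Proof.
elim: s => [|e s IH]; first by rewrite [all_occupied _](_ : _ = setT)//; apply/seteqP.
by rewrite all_occupied_cons; apply: measurableI => //; exact: measurable_occupied.
Qed.

(** Every event that depends only on the sites of [S] has this form; revealing the head of [S] fixes
    the first entry of the pattern. *)
Definition observed S G : set T := [set B : T | G [seq B e | e <- S]].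

Lemma observed_consl f S G :
  occupied f `&` observed (f :: S) G = occupied f `&` observed S (fun b => G (true :: b)).
Proof. by apply/seteqP; split=> B /= [Bf]; rewrite /observed/= (Bf : B f = true). Qed.

Lemma observed_consr f S G :
  ~` occupied f `&` observed (f :: S) G =
  ~` occupied f `&` observed S (fun b => G (false :: b)).
Proof.
by apply/seteqP; split=> B /= [/negP/negbTE Bf]; rewrite /observed/= Bf;
  split=> //; rewrite /occupied/= Bf.
Qed.

Lemma measurable_observed S G : measurable (observed S G).
Proof.
elim: S G => [|f S IH] G.
  rewrite (_ : observed _ _ = if G [::] then setT else set0); first by case: ifP.
  by apply/seteqP; split=> B; rewrite /observed/=; case: (G [::]).
rewrite -[observed _ _](setUIDK _ (occupied f)) setDE.
rewrite setIC observed_consl [_ `&` ~` _]setIC observed_consr.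
by apply: measurableU; apply: measurableI => //;
  [exact: measurable_occupied|exact: measurable_vacant].
Qed.

Definition mass X : F := of_real k (fine (P X)).

Lemma mass_ge0 X : 0 <= mass X.
Proof. by rewrite -(rmorph0 (of_real k)) ler_of_real fine_ge0. Qed.

Lemma le_mass X Y : measurable X -> measurable Y -> X `<=` Y -> mass X <= mass Y.
Proof.
move=> mX mY XY; rewrite ler_of_real fine_le ?fin_num_measure//.
by apply: le_measure => //; rewrite inE.
Qed.

Lemma mass_split X e : measurable X ->
  mass X = mass (X `&` occupied e) + mass (X `&` ~` occupied e).
Proof.
move=> mX; have mo := measurable_occupied e; have mv := measurable_vacant e.
rewrite -rmorphD -fineD ?fin_num_measure//; try exact: measurableI.
congr (of_real k (fine _)); rewrite -measureU; last 3 first.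
- exact: measurableI.
- exact: measurableI.
- by rewrite setIACA setICr setI0.
by rewrite -setIUr setUCr setIT.
Qed.

End occupation.

(** * Conditional laws after revealing sites *)

Section conditioning.
Variables (R : realType) (k : scalar_kind) (E : choiceType).
Variable P : probability (borel_powerset E) R.
Local Notation T := (borel_powerset E).
Local Notation F := (scalar_field R k).
Local Notation mass := (@mass R k E P).
Implicit Types (X Y : set T) (S s : seq E) (G : seq bool -> bool) (K : E -> E -> F).

(** Determinantal law conditional on [X], with the denominator cleared: null events [X] are allowed,
    and for them nothing is imposed on [K]. *)
Definition local_law X S K : Prop := forall s, uniq s -> {subset s <= S} ->
  mass (X `&` @all_occupied E s) = mass X * minor K s.

Lemma local_law_occupied X S K f : local_law X S K -> f \in S ->
  mass (X `&` @occupied E f) = mass X * K f f.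
Proof.
move=> law fS; have := law [:: f] isT.
rewrite all_occupied_cons (_ : all_occupied [::] = setT) ?setIT ?minor1; last exact/seteqP.
by apply=> g; rewrite inE => /eqP ->.
Qed.

Lemma local_law_vacant X S K f : measurable X -> local_law X S K -> f \in S ->
  mass (X `&` ~` @occupied E f) = mass X * (1 - K f f).
Proof.
move=> mX law fS; rewrite mulrBr mulr1 {1}(mass_split k P f mX).
rewrite -(local_law_occupied law fS).
by rewrite addrAC subrr add0r.
Qed.

Lemma local_law_in X S K f : local_law X (f :: S) K -> f \notin S ->
  K f f != 0 -> local_law (X `&` @occupied E f) S (schur K f (K f f)).
Proof.
move=> law fS k0 s us sS; rewrite (local_law_occupied law) ?mem_head// -setIA.
rewrite -all_occupied_cons law/=; last 2 first.
- by rewrite us andbT; apply: contra fS; exact: sS.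
- by move=> g; rewrite !inE => /orP[->//|/sS ->]; rewrite orbT.
by rewrite -mulrA minor_schur// subrr mul0r addr0.
Qed.

(** Inclusion-exclusion gives [mass X * (minor K s - minor K (f :: s))], which [minor_schur] with
    pivot [K f f - 1] factors into the mass of the vacancy event and the new minor. *)
Lemma local_law_out X S K f : measurable X -> local_law X (f :: S) K -> f \notin S ->
  K f f != 1 -> local_law (X `&` ~` @occupied E f) S (schur K f (K f f - 1)).
Proof.
move=> mX law fS k1 s us sS; rewrite (local_law_vacant mX law) ?mem_head//.
have fs : f \notin s by apply: contra fS; exact: sS.
have sS' : {subset s <= f :: S} by move=> g /sS gS; rewrite inE gS orbT.
have := mass_split k P f (measurableI _ _ mX (measurable_all_occupied s)).
rewrite 2!(setIAC X (all_occupied s)) -(setIA X) -all_occupied_cons.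
rewrite (law s us sS') (law (f :: s))/=; last 2 first.
- by rewrite fs us.
- by move=> g; rewrite !inE => /orP[->//|/sS ->]; rewrite orbT.
move/eqP; rewrite addrC -subr_eq => /eqP <-.
have k1' : K f f - 1 != 0 by rewrite subr_eq0.
by rewrite -[1 - K f f]opprB -mulrA mulNr minor_schur//; ring.
Qed.

(** Induction on [S] with [X], [G] and [K] varying: the head of [S] is revealed, each non-null half
    inherits the hypothesis through a Schur complement, and the two bounds add up. The witness [y]
    depends on the whole pattern and stays the same along the way. *)
Lemma mass_observed_vacant S (e : E) (t : F) X G K : 0 <= t -> measurable X ->
  hermitian_kernel (@scalar_conj R k) K -> uniq (rcons S e) ->
  local_law X (rcons S e) K ->
  (forall b, size b = size S -> G b -> exists y : E -> F,
    [/\ y e = 1, (forall p, p \in zip S b -> p.2 -> y p.1 = 0)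
      & dominated (@scalar_conj R k) K (rcons S e) y t]) ->
  mass (X `&` (@observed E S G `&` ~` @occupied E e)) <= t * mass X.
Proof.
move=> t0; elim: S X G K => [|f S IH] X G K mX hK.
  move=> _ law /(_ [::] erefl); case Gnil: (G [::]); last first.
    move=> _; rewrite (_ : _ `&` _ = set0).
      by rewrite /mass measure0 rmorph0 mulr_ge0// mass_ge0.
    by apply/seteqP; split=> B //= [_ [/=]]; rewrite /observed/= Gnil.
  case=> // y [ye _ dom].
  rewrite (_ : observed _ _ = setT); last by apply/seteqP; split=> B; rewrite /observed/=.
  rewrite setTI (local_law_vacant mX law) ?mem_head//.
  (* The constant test vector gives [1 <= (1 + t) * K e e], hence [1 - K e e <= t * K e e]. *)
  have := dom (fun=> 1); rewrite /pairing /sqn /qform/= !big_seq1 ye rmorph1 !mulr1 normr1.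
  rewrite !mul1r expr1n => dom1.
  have kE := local_law_occupied law (mem_head _ _).
  (* [K e e <= 1] is available only after multiplication by [mass X], which may vanish. *)
  have kle : mass X * K e e <= mass X.
    rewrite -kE; apply: le_mass => //.
    by apply: measurableI => //; exact: measurable_occupied.
  apply: (@le_trans _ _ (mass X * (t * K e e))).
    by rewrite ler_wpM2l ?mass_ge0// lerBlDr addrC -{1}[K e e]mul1r -mulrDl.
  by rewrite mulrCA ler_wpM2l.
rewrite rcons_cons /= => /andP[fS uS] law HG.
have mf := @measurable_occupied E f; have mv := @measurable_vacant E f.
have mO : measurable (observed (f :: S) G `&` ~` @occupied E e).
  by apply: measurableI; [exact: measurable_observed|exact: measurable_vacant].
rewrite (mass_split k P f (measurableI _ _ mX mO)) (mass_split k P f mX) mulrDr.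
have kR : scalar_conj (K f f) = K f f by rewrite -hK.
have fin := mem_head f (rcons S e).
apply: lerD.
(* A zero pivot makes [f] almost surely vacant on [X], so that this half is null. *)
- have [k0|k0] := eqVneq (K f f) 0.
    apply: le_trans (mulr_ge0 t0 (mass_ge0 _ _ _)).
    have -> : 0 = mass (X `&` occupied f).
      by rewrite (local_law_occupied law fin) k0 mulr0.
    apply: le_mass; [| |exact: setSI (@subIsetl _ _ _)].
    + by apply: measurableI => //; exact: measurableI.
    + exact: measurableI.
  rewrite setIAC setIA -(setIA X) observed_consl (setIA X) -setIA.
  apply: (IH _ _ (schur K f (K f f))) => //.
  + exact: measurableI.
  + exact: schur_hermitian.
  + exact: local_law_in.
  move=> b bS Gb; have [y [ye y0 dom]] := HG (true :: b) (congr1 succn bS) Gb.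
  exists y; split=> //; first by move=> p pSb; apply: y0; rewrite inE pSb orbT.
  apply: dominated_schur_in => //.
  by apply: (y0 (f, true)); rewrite ?mem_head.
- have [k1|k1] := eqVneq (K f f) 1.
    apply: le_trans (mulr_ge0 t0 (mass_ge0 _ _ _)).
    have -> : 0 = mass (X `&` ~` occupied f).
      by rewrite (local_law_vacant mX law fin) k1 subrr mulr0.
    apply: le_mass; [| |exact: setSI (@subIsetl _ _ _)].
    + by apply: measurableI => //; exact: measurableI.
    + exact: measurableI.
  (* Positivity of this mass yields [K f f < 1], the sign condition of [dominated_schur_out]; a null
     half is bounded directly. *)
  have [m0|m0] := eqVneq (mass (X `&` ~` occupied f)) 0.
    rewrite m0 mulr0 -m0.
    apply: le_mass; [| |exact: setSI (@subIsetl _ _ _)].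
    + by apply: measurableI => //; exact: measurableI.
    + exact: measurableI.
  have klt : K f f < 1.
    have mp : 0 < mass (X `&` ~` occupied f) by rewrite lt_def m0 mass_ge0.
    have Xp : 0 < mass X.
      by apply: lt_le_trans mp _; apply: le_mass => //; exact: measurableI.
    by move: mp; rewrite (local_law_vacant mX law fin) pmulr_rgt0// subr_gt0.
  rewrite setIAC setIA -(setIA X) observed_consr (setIA X) -setIA.
  apply: (IH _ _ (schur K f (K f f - 1))) => //.
  + exact: measurableI.
  + by apply: schur_hermitian => //; rewrite rmorphB rmorph1; congr (_ - _).
  + exact: local_law_out.
  move=> b bS Gb; have [y [ye y0 dom]] := HG (false :: b) (congr1 succn bS) Gb.
  exists y; split=> //; first by move=> p pSb; apply: y0; rewrite inE pSb orbT.
  apply: dominated_schur_out => //; [exact: scalar_normCE|exact: scalar_conjK|].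
  (* The site [e] is never revealed and [y e = 1], so the squared norm of [y] on the remaining sites
     is positive. *)
  apply: ltr_wpDr => //; rewrite /sqn -cats1 big_cat big_seq1 ye normr1 expr1n.
  by rewrite ltr_wpDl// sumr_ge0// => g _; rewrite exprn_ge0.
Qed.

End conditioning.

(** * Geometry of ell2 *)

Section scalar_limits.
Variables (R : realType) (k : scalar_kind).
Local Notation F := (scalar_field R k).

(** Positive elements of [R[i]] are real, so radii in the scalar field are real radii. *)
Lemma scalar_gt0P (e : F) : 0 < e -> exists2 e' : R, 0 < e' & e = of_real k e'.
Proof.
move: e; case: k => /= e e0; first by exists e.
case: e e0 => a b; rewrite ltcE /= => /andP[/eqP-> a0].
by exists a.
Qed.

Lemma cvg_of_real (T : Type) (G : set_system T) (FG : Filter G) (f : T -> R) (l : R) :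
  f @ G --> l -> (fun x => of_real k (f x)) @ G --> of_real k l.
Proof.
move=> fl; apply/cvgrPdist_lt => _ /scalar_gt0P[e e0 ->].
move/cvgrPdist_lt : fl => /(_ e e0); apply: filterS => x.
rewrite -rmorphB; set y := l - f x => /= ye.
rewrite -modulusE ltr_of_real; move: ye; suff -> : modulus (of_real k y) = `|y| by [].
by case: k => //=; rewrite expr0n addr0 sqrtr_sqr.
Qed.

Lemma scalar_conj_norm (z : F) : `|scalar_conj z| = `|z|.
Proof. by move: z; case: k => //= z; rewrite normcJ. Qed.

Lemma cvg_scalar_conj (T : Type) (G : set_system T) (FG : Filter G) (f : T -> F) (l : F) :
  f @ G --> l -> (fun x => scalar_conj (f x)) @ G --> scalar_conj l.
Proof.
move=> fl; apply/cvgrPdist_lt => e e0.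
move/cvgrPdist_lt : fl => /(_ e e0); apply: filterS => x.
by rewrite -rmorphB scalar_conj_norm.
Qed.

End scalar_limits.

Lemma real_polarization (R : realType) (a b : R) :
  a * b = 4^-1 * `|a + b| ^+ 2 + - 4^-1 * `|a - b| ^+ 2.
Proof. by rewrite !real_normK ?num_real//; field. Qed.

Lemma complex_polarization (R : realType) (a b : R[i]) :
  a * conjc b = 4^-1 * `|a + b| ^+ 2 + (- 4^-1 * `|a - b| ^+ 2 +
    (4^-1 * 'i%C * `|a + 'i%C * b| ^+ 2 +
      (- (4^-1 * 'i%C) * `|a - 'i%C * b| ^+ 2 + 0))).
Proof.
have cD (u v : R[i]) : conjc (u + v) = conjc u + conjc v by exact: rmorphD.
have cN (u : R[i]) : conjc (- u) = - conjc u by exact: rmorphN.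
have cM (u v : R[i]) : conjc (u * v) = conjc u * conjc v by exact: rmorphM.
have ci : conjc 'i%C = - 'i%C :> R[i] by apply/eqP; rewrite eq_complex /= oppr0 !eqxx.
have i2 : 'i%C * 'i%C = - 1 :> R[i] by rewrite -expr2 sqr_i.
rewrite !sqr_normc !(cD, cN, cM) ci.
apply: (@mulfI _ 4); rewrite ?pnatr_eq0//.
move: i2; move: 'i%C (conjc a) (conjc b) => i a' b' i2.
have -> : forall u v w t : R[i], 4 * (4^-1 * u + (- 4^-1 * v +
    (4^-1 * i * w + (- (4^-1 * i) * t + 0)))) = u - v + i * w - i * t.
  by move=> u v w t; field.
(* The left-hand side is padded with multiples of [i * i + 1], so that the remaining identity holds
   without the relation for [i]. *)
have -> : 4 * (a * b') = 2 * a * b' - i * i * 2 * a * b' + (2 + 2 * (i * i)) * b * a'.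
  by rewrite i2; ring.
ring.
Qed.

#[local] Existing Instance totally_filter.

Section ell2_geometry.
Variables (R : realType) (k : scalar_kind) (E : choiceType).
Local Notation F := (scalar_field R k).
Local Notation V := (ell2 R k E).
Implicit Types (x y z : V) (e : E).

Lemma ell2ZE a x e : (a *: x) e = a * x e. Proof. by []. Qed.
Lemma esum_ge_fset (f : E -> R) (A : {fset E}) : (forall e, 0 <= f e) ->
  ((\sum_(e <- A) f e)%:E <= \esum_(e in [set: E]) (f e)%:E)%E.
Proof.
move=> f0; apply: ereal_sup_ubound; exists [set` A]; first by split.
by rewrite fsbig_finite//= set_fsetK sumEFin.
Qed.

Lemma esum_le_fset (f : E -> R) (M : R) :
  (forall A : {fset E}, \sum_(e <- A) f e <= M) ->
  (\esum_(e in [set: E]) (f e)%:E <= M%:E)%E.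
Proof.
move=> fM; apply: ge_ereal_sup => _ [A [finA _] <-].
by rewrite fsbig_finite//= sumEFin lee_fin.
Qed.

Lemma sqsum_partial_le x (A : {fset E}) :
  \sum_(e <- A) modulus (x e) ^+ 2 <= l2norm x ^+ 2.
Proof.
rewrite -lee_fin -sqsum_l2norm.
apply: (esum_ge_fset A (f := fun e => modulus (x e) ^+ 2)).
by move=> e; exact: sqr_ge0.
Qed.

Lemma sqsum_partial_gt x (c : R) : c < l2norm x ^+ 2 ->
  exists A : {fset E}, c < \sum_(e <- A) modulus (x e) ^+ 2.
Proof.
move=> cx; apply: contrapT => /forallNP H.
have : (sqsum x <= c%:E)%E.
  by apply: esum_le_fset => A; have := H A => /negP; rewrite -leNgt.
by rewrite sqsum_l2norm lee_fin leNgt cx.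
Qed.

Lemma le_sum_subset (f : E -> R) (s t : seq E) : (forall e, 0 <= f e) ->
  uniq s -> uniq t -> {subset s <= t} -> \sum_(e <- s) f e <= \sum_(e <- t) f e.
Proof.
move=> f0 us ut st.
rewrite [leRHS](bigID (mem s) predT)/= -[X in X + _]big_filter.
have -> : \sum_(e <- s) f e = \sum_(e <- [seq e <- t | e \in s]) f e.
  apply: perm_big; apply: uniq_perm; rewrite ?filter_uniq// => e.
  by rewrite mem_filter andb_idr//; exact: st.
by rewrite lerDl sumr_ge0.
Qed.

Lemma partial_sumE (f : E -> F) (A : {fset E}) : partial_sum f A = \sum_(e <- A) f e.
Proof. by rewrite /partial_sum [RHS]big_seq_fsetE. Qed.

Lemma cvg_sqsum x :
  (fun A : {fset E} => \sum_(e <- A) modulus (x e) ^+ 2) @ totally --> l2norm x ^+ 2.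
Proof.
apply/cvgrPdist_lt => c c0.
have [A hA] : exists A : {fset E}, l2norm x ^+ 2 - c < \sum_(e <- A) modulus (x e) ^+ 2.
  by apply: sqsum_partial_gt; rewrite ltrBlDr ltrDl.
exists A => // B /= AB; rewrite ger0_norm ?subr_ge0 ?sqsum_partial_le//.
rewrite ltrBlDr -ltrBlDl; apply: lt_le_trans hA _.
by apply: le_sum_subset => [e||| e]; rewrite ?sqr_ge0 ?fset_uniq//; exact/fsubsetP.
Qed.

(** The list does not depend on [e], so convergence of the series defining [dotp] follows from that
    of finitely many square sums. *)
Lemma polarization x y : exists s : seq (F * V),
  forall e, x e * scalar_conj (y e) = \sum_(p <- s) p.1 * `|p.2 e| ^+ 2.
Proof.
move: x y; case: k => x y.
  exists [:: (4^-1, x + y); (- 4^-1, x - y)] => e.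
  by rewrite big_cons big_seq1; exact: real_polarization.
pose i : scalar_field R ComplexScalars := 'i%C.
exists [:: (4^-1, x + y); (- 4^-1, x - y);
  (4^-1 * i, x + i *: y); (- (4^-1 * i), x - i *: y)] => e.
by rewrite !big_cons big_nil; exact: complex_polarization.
Qed.

Lemma cvg_dotp x y :
  partial_sum (fun e => x e * scalar_conj (y e)) @ totally --> dotp x y.
Proof.
suff : cvg (partial_sum (fun e => x e * scalar_conj (y e)) @ totally) by [].
have [s sE] := polarization x y.
pose l := \sum_(p <- s) p.1 * of_real k (l2norm p.2 ^+ 2).
apply/cvg_ex; exists l.
have -> : partial_sum (fun e => x e * scalar_conj (y e)) =
    fun A : {fset E} =>
      \sum_(p <- s) p.1 * of_real k (\sum_(e <- A) modulus (p.2 e) ^+ 2).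
  apply/funext => A; rewrite partial_sumE; under eq_bigr do rewrite sE.
  rewrite exchange_big/=; apply: eq_bigr => p _; rewrite rmorph_sum mulr_sumr.
  by apply: eq_bigr => e _; rewrite rmorphXn/= modulusE.
rewrite /l; elim: s {sE l} => [|p s IH].
  by rewrite big_nil; under eq_fun do rewrite big_nil; exact: cvg_cst.
rewrite big_cons; under eq_fun do rewrite big_cons.
apply: cvgD => //; apply: cvgM; first exact: cvg_cst.
by apply: cvg_of_real; exact: cvg_sqsum.
Qed.

Lemma dotp_unique x y (l : F) :
  partial_sum (fun e => x e * scalar_conj (y e)) @ totally --> l -> dotp x y = l.
Proof. by move=> xyl; apply: cvg_lim xyl; exact: norm_hausdorff. Qed.

Lemma dotpDl x y z : dotp (x + y) z = dotp x z + dotp y z.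
Proof.
apply: dotp_unique; rewrite (_ : partial_sum _ =
  partial_sum (fun e => x e * scalar_conj (z e)) \+
  partial_sum (fun e => y e * scalar_conj (z e))).
  by apply: cvgD; exact: cvg_dotp.
apply/funext => A; rewrite /= !partial_sumE -big_split.
by apply: eq_bigr => e _; exact: mulrDl.
Qed.

Lemma dotpZl a x z : dotp (a *: x) z = a * dotp x z.
Proof.
apply: dotp_unique; rewrite (_ : partial_sum _ =
  (fun=> a) \* partial_sum (fun e => x e * scalar_conj (z e))).
  by apply: cvgM; [exact: cvg_cst | exact: cvg_dotp].
apply/funext => A; rewrite /= !partial_sumE mulr_sumr.
by apply: eq_bigr => e _; exact: (esym (mulrA _ _ _)).
Qed.

Lemma dotpC x y : dotp y x = scalar_conj (dotp x y).
Proof.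
apply: dotp_unique; rewrite (_ : partial_sum _ = fun A : {fset E} =>
  scalar_conj (partial_sum (fun e => x e * scalar_conj (y e)) A)).
  by apply: cvg_scalar_conj; exact: cvg_dotp.
apply/funext => A; rewrite !partial_sumE rmorph_sum.
by apply: eq_bigr => e _; rewrite rmorphM/= scalar_conjK mulrC.
Qed.

Lemma dotpxx x : dotp x x = of_real k (l2norm x ^+ 2).
Proof.
apply: dotp_unique; rewrite (_ : partial_sum _ = fun A : {fset E} =>
  of_real k (\sum_(e <- A) modulus (x e) ^+ 2)).
  by apply: cvg_of_real; exact: cvg_sqsum.
apply/funext => A; rewrite !partial_sumE rmorph_sum.
by apply: eq_bigr => e _; rewrite rmorphXn/= modulusE scalar_normCE.
Qed.

Lemma dotp_std x e : dotp x (std_basis R k e) = x e.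
Proof.
apply: dotp_unique; apply/cvgrPdist_lt => c c0.
exists [fset e]%fset => // A /=; rewrite fsub1set => eA.
rewrite partial_sumE (big_fsetD1 e)//= eqxx rmorph1 mulr1.
rewrite big1_fset ?addr0 ?subrr ?normr0//.
by move=> f; rewrite !inE => /andP[/negbTE fe _] _; rewrite fe rmorph0 mulr0.
Qed.

End ell2_geometry.

Lemma normB_line_subproof (F : fieldType) (X D D' N : F) : N != 0 ->
  X - D' / N * D - (D / N * D' - D / N * (D' / N * N)) = X - D * D' / N.
Proof. by move=> N0; field. Qed.

Lemma parallelogram_subproof (F : comPzRingType) (a b c d : F) :
  a + b + (c + d) + (a - b - (c - d)) = a + d + (a + d).
Proof. by ring. Qed.

Section inner_product.
Variables (R : realType) (k : scalar_kind) (E : choiceType).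
Local Notation F := (scalar_field R k).
Local Notation V := (ell2 R k E).
Implicit Types (x y z : V) (e : E).

Lemma dotpBl x y z : dotp (x - y) z = dotp x z - dotp y z.
Proof. by rewrite -scaleN1r dotpDl dotpZl mulN1r. Qed.

Lemma dotp0l z : dotp 0 z = 0.
Proof. by rewrite -(scale0r (0 : V)) dotpZl mul0r. Qed.

Lemma dotp_suml (I : Type) (s : seq I) (f : I -> V) z :
  dotp (\sum_(i <- s) f i) z = \sum_(i <- s) dotp (f i) z.
Proof. by apply: (big_morph (fun x => dotp x z)) => [x y|]; rewrite (dotpDl, dotp0l). Qed.

Lemma dotpDr x y z : dotp z (x + y) = dotp z x + dotp z y.
Proof. by rewrite dotpC dotpDl rmorphD/= -!dotpC. Qed.

Lemma dotpBr x y z : dotp z (x - y) = dotp z x - dotp z y.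
Proof. by rewrite dotpC dotpBl rmorphB/= -!dotpC. Qed.

Lemma dotpZr a x z : dotp z (a *: x) = scalar_conj a * dotp z x.
Proof. by rewrite dotpC dotpZl rmorphM/= -dotpC. Qed.

Lemma dotp_sumr (I : Type) (s : seq I) (f : I -> V) z :
  dotp z (\sum_(i <- s) f i) = \sum_(i <- s) dotp z (f i).
Proof.
rewrite dotpC dotp_suml rmorph_sum; apply: eq_bigr => i _.
by rewrite /= -dotpC.
Qed.

Lemma dotp_norm x : dotp x x = `|x| ^+ 2.
Proof. by rewrite dotpxx rmorphXn. Qed.

(** Pythagoras for the component of [x] along [z]. Nonnegativity of the left-hand side gives
    Cauchy-Schwarz; at a nearest point the identity forces orthogonality. *)
Lemma normB_line x z : z != 0 ->
  `|x - (dotp x z / `|z| ^+ 2) *: z| ^+ 2 = `|x| ^+ 2 - `|dotp x z| ^+ 2 / `|z| ^+ 2.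
Proof.
move=> z0; have nz : `|z| != 0 by rewrite normr_eq0.
have cz : scalar_conj (`|z| ^+ 2) = `|z| ^+ 2 by rewrite -dotp_norm -dotpC.
set N := `|z| ^+ 2 in cz *; have N0 : N != 0 by rewrite expf_neq0.
set D := dotp x z; have zx : dotp z x = scalar_conj D by rewrite -dotpC.
have -> : `|D| ^+ 2 = D * scalar_conj D := scalar_normCE D.
have cc : scalar_conj (D / N) = scalar_conj D / N.
  by rewrite -[in RHS]cz -fmorphV; exact: (rmorphM (@scalar_conj R k)).
rewrite -dotp_norm dotpBl !dotpBr !dotpZl !dotpZr cc zx !dotp_norm -/N -/D.
exact: normB_line_subproof.
Qed.

Lemma dotp_Cauchy_Schwarz x z : `|dotp x z| ^+ 2 <= `|x| ^+ 2 * `|z| ^+ 2.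
Proof.
have [->|z0] := eqVneq z 0.
  by rewrite (dotpC 0 x) dotp0l rmorph0 !normr0 !expr0n mulr0.
have nz : 0 < `|z| ^+ 2 by rewrite exprn_gt0// normr_gt0.
rewrite -ler_pdivrMr// -subr_ge0 -normB_line//.
Qed.

Lemma parallelogram x y :
  l2norm (x + y) ^+ 2 + l2norm (x - y) ^+ 2 =
  l2norm x ^+ 2 + l2norm y ^+ 2 + (l2norm x ^+ 2 + l2norm y ^+ 2).
Proof.
apply: (fmorph_inj (of_real k)).
rewrite !rmorphD/= -!dotpxx !(dotpBl, dotpBr, dotpDl, dotpDr).
exact: parallelogram_subproof.
Qed.

Lemma l2normN x : l2norm (- x) = l2norm x.
Proof. by apply: (fmorph_inj (of_real k)); exact: (normrN x). Qed.

Lemma l2norm_distC x y : l2norm (x - y) = l2norm (y - x).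
Proof. by rewrite -l2normN opprB. Qed.

Lemma modulus_le_l2norm x e : modulus (x e) <= l2norm x.
Proof.
rewrite -ler_sqr ?nnegrE ?modulus_ge0 ?l2norm_ge0//.
by apply: le_trans (sqsum_partial_le x [fset e]%fset); rewrite big_seq_fset1.
Qed.

Lemma closure_l2normP (S : set V) y :
  closure S y <-> forall e : R, 0 < e -> exists2 h, S h & l2norm (y - h) < e.
Proof.
split=> [cy e e0|H B /nbhs_ballP[_/= /scalar_gt0P[e e0 ->] eB]].
  have e0' : 0 < of_real k e by rewrite -[0](rmorph0 (of_real k)) ltr_of_real.
  have [h [Sh]] := cy _ (nbhsx_ballx y _ e0').
  by rewrite -ball_normE /ball_/= => he; exists h => //; rewrite -(ltr_of_real k).
have [h Sh he] := H e e0; exists h; split=> //; apply: eB.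
by rewrite -ball_normE /ball_/= (_ : `|y - h| = of_real k (l2norm (y - h)))// ltr_of_real.
Qed.

End inner_product.

(** * Completeness of the scalars and of [ell2] *)

Section completeness.
Variables (R : realType).

Lemma real_complete (u : nat -> R) :
  (forall e : R, 0 < e -> exists N, forall m n,
    (N <= m)%N -> (N <= n)%N -> `|u m - u n| <= e) ->
  exists l : R, u n @[n --> \oo] --> l.
Proof.
move=> cu; apply/cvg_ex/cauchy_cvgP/cauchy_exP => e e0.
have /cu[N HN] : 0 < e / 2 by rewrite divr_gt0.
exists (u N); exists N => // n /= Nn; rewrite -ball_normE /ball_/=.
by apply: le_lt_trans (HN _ _ (leqnn _) Nn) _; rewrite ltr_pdivrMr// mulr2n; lra.
Qed.

Variable k : scalar_kind.
Local Notation F := (scalar_field R k).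

Lemma scalar_complete (u : nat -> F) :
  (forall e : R, 0 < e -> exists N, forall m n,
    (N <= m)%N -> (N <= n)%N -> modulus (u m - u n) <= e) ->
  exists l : F, modulus (u n - l) @[n --> \oo] --> (0 : R).
Proof.
move: u; case: k => u cu.
  have [l ul] := real_complete cu; exists l.
  apply/cvgrPdist_le => e e0; move/cvgrPdist_le : ul => /(_ e e0).
  by apply: filterS => n; rewrite sub0r normrN normr_id distrC.
have ReM (z : R[i]) : `|complex.Re z| <= @modulus R ComplexScalars z.
  by case: z => a b /=; rewrite -sqrtr_sqr ler_sqrt ?addr_ge0 ?sqr_ge0// lerDl sqr_ge0.
have ImM (z : R[i]) : `|complex.Im z| <= @modulus R ComplexScalars z.
  by case: z => a b /=; rewrite -sqrtr_sqr ler_sqrt ?addr_ge0 ?sqr_ge0// lerDr sqr_ge0.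
have [|a ua] := @real_complete (fun n => complex.Re (u n)).
  move=> e /cu[N HN]; exists N => m n Nm Nn; apply: le_trans (HN m n Nm Nn).
  by rewrite -raddfB; exact: ReM.
have [|b ub] := @real_complete (fun n => complex.Im (u n)).
  move=> e /cu[N HN]; exists N => m n Nm Nn; apply: le_trans (HN m n Nm Nn).
  by rewrite -raddfB; exact: ImM.
exists (a +i* b)%C.
have h : Num.sqrt ((complex.Re (u n) - a) ^+ 2 + (complex.Im (u n) - b) ^+ 2)
    @[n --> \oo] --> (0 : R).
  rewrite -[0](sqrtr0 R); apply: continuous_cvg; first exact: sqrt_continuous.
  have -> : 0 = (a - a) * (a - a) + (b - b) * (b - b) :> R by rewrite !subrr mulr0 addr0.
  by apply: cvgD; apply: cvgM; apply: cvgB => //; exact: cvg_cst.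
apply: cvg_trans h; apply: near_eq_cvg; near=> n => /=.
by case: (u n).
Unshelve. all: by end_near.
Qed.

End completeness.

Section ell2_completeness.
Variables (R : realType) (k : scalar_kind) (E : choiceType).
Local Notation F := (scalar_field R k).
Local Notation V := (ell2 R k E).
Implicit Types (x y z : V) (e : E).

Lemma cvg_modulusB (u : nat -> F) (c l : F) :
  modulus (u n - l) @[n --> \oo] --> (0 : R) ->
  modulus (c - u n) @[n --> \oo] --> modulus (c - l).
Proof.
move=> ul; have mN (z : F) : modulus (- z) = modulus z.
  by apply: (fmorph_inj (of_real k)); rewrite /= !modulusE normrN.
apply/cvgrPdist_le => e e0; move/cvgrPdist_le : ul => /(_ e e0).
apply: filterS => n; rewrite sub0r normrN ger0_norm ?modulus_ge0// => une.
have := ler_modulusD (c - l) (l - u n); rewrite subrKA -(mN (l - u n)) opprB => t1.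
have := ler_modulusD (c - u n) (u n - l); rewrite subrKA => t2.
rewrite ler_norml; apply/andP; split; lra.
Qed.

(** Coordinates converge by completeness of the scalars. The Cauchy bound passes to the
    coordinatewise limit on each finite set of coordinates, then to the supremum over these sets. *)
Lemma ell2_complete (u : nat -> V) :
  (forall e : R, 0 < e -> exists N, forall m n, (N <= m)%N -> (N <= n)%N ->
     l2norm (u m - u n) <= e) ->
  exists l, forall e : R, 0 < e ->
    exists N, forall n, (N <= n)%N -> l2norm (u n - l) <= e.
Proof.
move=> cu.
have /choice[l ul] e : exists l : F, modulus (u n e - l) @[n --> \oo] --> (0 : R).
  apply: scalar_complete => c /cu[N HN]; exists N => m n Nm Nn.
  by apply: le_trans (HN m n Nm Nn); exact: (modulus_le_l2norm (u m - u n)).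
have bound (c : R) N n : (0 < c) -> (forall m n, (N <= m)%N -> (N <= n)%N ->
     l2norm (u m - u n) <= c) -> (N <= n)%N ->
     (sqsum (fun e => u n e - l e)%R <= (c ^+ 2)%:E)%E.
  move=> c0 HN Nn; apply: esum_le_fset => A.
  have h : \sum_(e <- A) modulus (u n e - u m e) ^+ 2 @[m --> \oo] -->
      \sum_(e <- A) modulus (u n e - l e) ^+ 2.
    by apply: cvg_big => [|e _]; [exact: add_continuous|apply: cvgM; exact: cvg_modulusB].
  apply: (@cvgr_to_le _ _ _ _ _ _ _ h).
  exists N => // m /= Nm; apply: le_trans (sqsum_partial_le (u n - u m) A) _.
  by rewrite ler_sqr ?nnegrE ?l2norm_ge0 ?(ltW c0)//; exact: HN.
have [N HN] := cu 1 ltr01.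
have wP : (fun e => u N e - l e) \in @square_summable R k E.
  by rewrite inE; apply: le_lt_trans (bound _ _ _ ltr01 HN (leqnn N)) _; rewrite ltry.
(* The coordinatewise limit is not yet known to lie in [ell2], but [u N - l] is square-summable, and
   the limit is recovered as [u N - (u N - l)]. *)
exists (u N - Ell2 wP) => c c0; have [M HM] := cu c c0.
exists M => n Mn; rewrite -ler_sqr ?nnegrE ?l2norm_ge0 ?(ltW c0)//.
rewrite -lee_fin -sqsum_l2norm; apply: le_trans (bound _ _ _ c0 HM Mn).
rewrite le_eqVlt; apply/orP; left; apply/eqP; congr sqsum; apply/funext => e.
rewrite (_ : (u n - (u N - Ell2 wP)) e = u n e - (u N e - (u N e - l e)))//.
by rewrite subKr.
Qed.

End ell2_completeness.

(** * Orthogonal projection onto a closed subspace *)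

Section projection.
Variables (R : realType) (k : scalar_kind) (E : choiceType).
Local Notation F := (scalar_field R k).
Local Notation V := (ell2 R k E).
Variable H : set V.
Hypothesis H_submod : submod_closed [in H].
Hypothesis H_closed : closed H.
Implicit Types (x y z : V).

Lemma submod0 : H 0. Proof. by case: H_submod => + _; rewrite /in_mem/= => /asboolP. Qed.

Lemma submodD a x y : H x -> H y -> H (a *: x + y).
Proof. by case: H_submod => _ + Hx Hy => /(_ a x y (mem_set Hx) (mem_set Hy))/set_mem. Qed.

Lemma submodZ a x : H x -> H (a *: x).
Proof. by move=> Hx; rewrite -[_ *: _]addr0; apply: submodD => //; exact: submod0. Qed.

Lemma submodB x y : H x -> H y -> H (x - y).
Proof. by move=> Hx Hy; rewrite addrC -scaleN1r; exact: submodD. Qed.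

Lemma submod_sum (I : Type) (s : seq I) (c : I -> F) (v : I -> V) :
  (forall i, H (v i)) -> H (\sum_(i <- s) c i *: v i).
Proof.
move=> Hv; elim: s => [|i s IH]; first by rewrite big_nil; exact: submod0.
by rewrite big_cons; exact: submodD.
Qed.

(** If [x - y] had a nonzero component [c *: z] along [z], then by [normB_line] the point
    [c *: z + y] of [H] would be strictly nearer to [x]. *)
Lemma nearest_orthogonal x y : H y ->
  (forall h, H h -> l2norm (x - y) <= l2norm (x - h)) ->
  forall z, H z -> dotp (x - y) z = 0.
Proof.
move=> Hy ymin z Hz; have [->|z0] := eqVneq z 0.
  by rewrite dotpC dotp0l rmorph0.
set c := dotp (x - y) z / `|z| ^+ 2.
have := ymin (c *: z + y) (submodD c Hz Hy).
rewrite opprD addrA addrAC -(ler_of_real k) => le1.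
have := normB_line (x - y) z0; rewrite -/c => eqc.
have {le1} : `|x - y| ^+ 2 <= `|x - y - c *: z| ^+ 2 by rewrite ler_sqr ?nnegrE.
rewrite {}eqc lerBrDr gerDl => le1.
have nz : 0 < `|z| ^+ 2 by rewrite exprn_gt0// normr_gt0.
move: le1; rewrite pmulr_lle0 ?invr_gt0// => le1.
have : `|dotp (x - y) z| ^+ 2 == 0 by rewrite eq_le le1 exprn_ge0.
by rewrite sqrf_eq0 normr_eq0 => /eqP.
Qed.

(** A minimizing sequence is Cauchy by the parallelogram law, since midpoints of its terms stay in
    [H]. *)
Lemma nearest_exists x : exists2 y, H y & forall h, H h -> l2norm (x - y) <= l2norm (x - h).
Proof.
pose D := [set l2norm (x - h) | h in H]; set d := inf D.
have Dinf : has_inf D.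
  split; first by exists (l2norm (x - 0)), 0 => //; exact: submod0.
  by exists 0 => _ [h _ <-]; exact: l2norm_ge0.
have dle h : H h -> d <= l2norm (x - h) by move=> Hh; apply: ge_inf; [case: Dinf|exists h].
have d0 : 0 <= d by apply: lb_le_inf; [case: Dinf|move=> _ [h _ <-]; exact: l2norm_ge0].
have /choice[u uP] n : exists h, H h /\ l2norm (x - h) < d + n.+1%:R^-1.
  have [|_ [h Hh <-] hd] := @inf_adherent _ D n.+1%:R^-1 _ Dinf; first by rewrite invr_gt0.
  by exists h.
(* The bound is [4 * (d + c) ^+ 2 - 4 * d ^+ 2]: in the parallelogram law, the midpoint is at
   distance at least [d] from [x]. *)
have close m n c : 0 < c -> l2norm (x - u m) <= d + c -> l2norm (x - u n) <= d + c ->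
    l2norm (u m - u n) ^+ 2 <= 4 * c * (2 * d + c).
  move=> c0 hm hn; have [Hm _] := uP m; have [Hn _] := uP n.
  have := parallelogram (x - u n) (x - u m).
  have -> : x - u n - (x - u m) = u m - u n by rewrite opprB addrC subrKA.
  have -> : x - u n + (x - u m) = 2 *: (x - (2^-1 *: (u n) + 2^-1 *: u m)).
    rewrite scalerBr scalerDr !scalerA divff ?pnatr_eq0// !scale1r scaler_nat mulr2n.
    by rewrite opprD addrACA.
  have := dle _ (submodD 2^-1 Hn (submodZ 2^-1 Hm)).
  rewrite l2normZ; set a := l2norm (x - (_ + _)) => da.
  have -> : modulus (2 : F) = 2.
    by apply: (fmorph_inj (of_real k)); rewrite /= modulusE normr_nat rmorphMn rmorph1.
  move: hm hn (l2norm_ge0 (x - u m)) (l2norm_ge0 (x - u n)).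
  move: (l2norm (x - u m)) (l2norm (x - u n)) (l2norm (u m - u n)) => p q r *.
  nra.
have invS (c : R) : 0 < c -> exists N, forall n, (N <= n)%N -> n.+1%:R^-1 <= c.
  move=> /ltr_add_invr[N]; rewrite add0r => Nc; exists N => n Nn.
  by apply: le_trans (ltW Nc); rewrite lef_pV2 ?posrE ?ltr0n// ler_nat.
have [|y uy] := ell2_complete (u := u).
  (* [c <= 1] bounds [2 * d + c] by [2 * d + 1], and the second entry then brings the bound of
     [close] down to [e ^+ 2]. *)
  move=> e e0; pose c := Num.min 1 (e ^+ 2 / (4 * (2 * d + 1))).
  have d1 : 0 < 4 * (2 * d + 1) by lra.
  have c0 : 0 < c by rewrite lt_min ltr01 divr_gt0// exprn_gt0.
  have [N HN] := invS c c0; exists N => m n Nm Nn.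
  rewrite -ler_sqr ?nnegrE ?l2norm_ge0 ?(ltW e0)//.
  have cn p : (N <= p)%N -> l2norm (x - u p) <= d + c.
    by move=> Np; apply: ltW (lt_le_trans (proj2 (uP p)) _); rewrite lerD2l HN.
  apply: le_trans (close m n c c0 (cn m Nm) (cn n Nn)) _.
  have c1 : c <= 1 by rewrite ge_min lexx.
  have c2 : c * (4 * (2 * d + 1)) <= e ^+ 2 by rewrite -ler_pdivlMr// ge_min lexx orbT.
  by apply: le_trans c2; nra.
exists y.
  apply: H_closed; apply/closure_l2normP => e e0.
  have [N /(_ N (leqnn N)) uN] := uy (e / 2) (divr_gt0 e0 (ltr0n _ 2)).
  exists (u N); first by case: (uP N).
  by rewrite l2norm_distC; lra.
move=> h Hh; apply/ler_addgt0Pr => e e0.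
have e2 : 0 < e / 2 by rewrite divr_gt0.
have [N uN] := uy _ e2; have [M HM] := invS _ e2.
rewrite [leRHS](_ : _ = l2norm (x - h) + e / 2 + e / 2); last by rewrite -addrA -splitr.
rewrite -(subrKA (u (maxn N M))).
apply: le_trans (ler_l2normD _ _) _; apply: lerD; last exact/uN/leq_maxl.
apply: le_trans (ltW (proj2 (uP _))) _; apply: lerD; first exact: dle.
exact/HM/leq_maxr.
Qed.

Definition is_projection x y := H y /\ forall z, H z -> dotp (x - y) z = 0.

Lemma orth_projP x : is_projection x (orth_proj H x).
Proof.
have [y Hy ymin] := nearest_exists x.
have : is_projection x y by split=> //; exact: nearest_orthogonal.
exact: getI.
Qed.

Lemma orth_proj_in x : H (orth_proj H x).
Proof. by case: (orth_projP x). Qed.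

Lemma dotp_orth_projr x h : H h -> dotp h (orth_proj H x) = dotp h x.
Proof.
move=> Hh; apply/esym/eqP; rewrite -subr_eq0 -dotpBr dotpC.
by case: (orth_projP x) => _ ->//; rewrite rmorph0.
Qed.

End projection.

(** * Closed linear spans *)

Section span.
Variables (R : realType) (k : scalar_kind) (E : choiceType).
Local Notation F := (scalar_field R k).
Local Notation V := (ell2 R k E).
Implicit Types (H S : set V) (x y z : V).

Lemma lspan_sub S : S `<=` lspan S.
Proof.
move=> x Sx; exists 1, (fun=> 1), (fun=> x); split=> //.
by rewrite big_ord1 scale1r.
Qed.

Lemma lspan0 S : lspan S 0.
Proof. by exists 0, (fun=> 0), (fun=> 0); split=> [[]//|]; rewrite big_ord0. Qed.

Lemma lspan_lin S a x y : lspan S x -> lspan S y -> lspan S (a *: x + y).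
Proof.
move=> [n [c [v [Sv ->]]]] [m [d [w [Sw ->]]]].
exists (n + m)%N, (fun i => match fintype.split i with inl i => a * c i | inr j => d j end),
  (fun i => match fintype.split i with inl i => v i | inr j => w j end); split.
  by move=> i; case: fintype.split.
rewrite big_split_ord /= scaler_sumr; congr (_ + _); apply: eq_bigr => i _.
  by rewrite (unsplitK (inl i)) scalerA.
by rewrite (unsplitK (inr i)).
Qed.

Lemma closure_lspan_submod S : submod_closed [in closure (lspan S)].
Proof.
split=> [|a x y /set_mem xS /set_mem yS]; apply: mem_set.
  by apply: subset_closure; exact: lspan0.
apply/closure_l2normP => e e0.
have ma := modulus_ge0 a; have a1 : 0 < modulus a + 1 by lra.
have e1 : 0 < e / 2 / (modulus a + 1) by rewrite !divr_gt0.
have e2 : 0 < e / 2 by rewrite divr_gt0.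
have [x' Sx' xx'] := (closure_l2normP _ _).1 xS _ e1.
have [y' Sy' yy'] := (closure_l2normP _ _).1 yS _ e2.
exists (a *: x' + y'); first exact: lspan_lin.
rewrite opprD addrACA -scalerBr.
apply: le_lt_trans (ler_l2normD _ _) _; rewrite l2normZ.
have : modulus a * l2norm (x - x') <= e / 2.
  apply: le_trans (_ : (modulus a + 1) * l2norm (x - x') <= _).
    by rewrite ler_wpM2r ?l2norm_ge0// lerDl.
  by rewrite mulrC -ler_pdivlMr// ltW.
lra.
Qed.

(** For [h] in [H], subtracting its projection onto the closed span leaves an element of [H]
    orthogonal to [S], hence zero. *)
Lemma closure_lspan_total H S : submod_closed [in H] -> closed H -> S `<=` H ->
  (forall h, H h -> (forall s, S s -> dotp h s = 0) -> h = 0) ->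
  closure (lspan S) = H.
Proof.
move=> Hs Hc SH total.
have DH : closure (lspan S) `<=` H.
  apply: subset_trans Hc; apply: closureS => _ [n [c [v [Sv ->]]]].
  by apply: submod_sum => // i; exact/SH/Sv.
apply/seteqP; split=> // h Hh; have Ds := closure_lspan_submod S.
have Dc : closed (closure (lspan S)) by exact: closed_closure.
have [Dp orth] := orth_projP Ds Dc h.
suff /eqP : h - orth_proj (closure (lspan S)) h = 0 by rewrite subr_eq0 => /eqP ->.
apply: total; first by apply: submodB => //; exact: DH.
by move=> s Ss; apply: orth; apply: subset_closure; exact: lspan_sub.
Qed.

End span.

(** * The determinantal measure *)

Section liminf.
Variables (d : measure_display) (T : measurableType d) (R : realType).
Variable mu : {measure set T -> \bar R}.

Definition eventually_all (A : (set T)^nat) : set T :=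
  \bigcup_n \bigcap_(m in [set m | (n <= m)%N]) A m.

Lemma measurable_eventually_all A : (forall n, measurable (A n)) ->
  measurable (eventually_all A).
Proof.
move=> mA; apply: bigcup_measurable => n _.
by apply: bigcap_measurable => //; exists n => /=.
Qed.

(** The intersections of tails increase to the lower limit, and the one starting at [n] lies in
    [A n]. *)
Lemma measure_eventually_all_le A (c : \bar R) : (forall n, measurable (A n)) ->
  (forall n, (mu (A n) <= c)%E) -> (mu (eventually_all A) <= c)%E.
Proof.
move=> mA Ac; have mC n : measurable (\bigcap_(m in [set m | (n <= m)%N]) A m).
  by apply: bigcap_measurable => //; exists n => /=.
have := @nondecreasing_cvg_mu _ _ _ mu _ mC (measurable_eventually_all mA).
move=> /(_ _)/cvge_to_le; apply.
  by move=> n m nm; apply/subsetPset => x Ax p /= mp; apply: Ax; exact: leq_trans mp.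
apply: nearW => n; apply: le_trans (Ac n); apply: le_measure; rewrite ?inE//.
by apply: bigcap_inf => /=.
Qed.

End liminf.

(** * The projection kernel and its null events *)

Section kernel.
Variables (R : realType) (k : scalar_kind) (E : countType).
Local Notation F := (scalar_field R k).
Local Notation V := (ell2 R k E).
Variables (H : set V) (P : probability (borel_powerset E) R).
Hypotheses (H_submod : submod_closed [in H]) (H_closed : closed H).
Hypothesis P_law : determinantal_law H P.
Local Notation delta := (std_basis R k).

Definition proj_kernel (g h : E) : F := dotp (orth_proj H (delta g)) (delta h).

Lemma proj_kernelE g h :
  proj_kernel g h = dotp (orth_proj H (delta g)) (orth_proj H (delta h)).
Proof. by rewrite dotp_orth_projr//; exact: orth_proj_in. Qed.

Lemma proj_kernel_hermitian : hermitian_kernel (@scalar_conj R k) proj_kernel.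
Proof. by move=> g h; rewrite !proj_kernelE; exact: dotpC. Qed.

Lemma local_law_proj_kernel (S : seq E) : @local_law R k E P setT S proj_kernel.
Proof.
move=> s us _; rewrite setTI {2}/mass probability_setT/= rmorph1 mul1r.
have sA : perm_eq s [fset x in s]%fset.
  by apply: uniq_perm; rewrite ?fset_uniq// => x; rewrite inE.
rewrite (perm_minor _ sA) -[RHS](P_law [fset x in s]%fset); congr (of_real k (fine (P _))).
apply/seteqP; split=> B /=; first by move=> /allP Bs e; rewrite inE => /Bs.
by move=> Bs; apply/allP => e es; apply: Bs; rewrite inE.
Qed.

(** With [Z] the projection of the combination of basis vectors with coefficients [z], the pairing
    is [(h, Z)] and the quadratic form is [|Z|^2], so Cauchy-Schwarz applies. *)
Lemma dominated_proj_kernel S h c : H h ->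
  l2norm h ^+ 2 <= \sum_(g <- S) modulus (h g) ^+ 2 + c ->
  dominated (@scalar_conj R k) proj_kernel S h (of_real k c).
Proof.
move=> Hh hc z; pose Z := \sum_(g <- S) z g *: orth_proj H (delta g).
have -> : pairing (@scalar_conj R k) S h z = dotp h Z.
  rewrite dotp_sumr; apply: eq_bigr => g _.
  by rewrite dotpZr dotp_orth_projr// dotp_std mulrC.
have -> : qform (@scalar_conj R k) proj_kernel S z = `|Z| ^+ 2.
  rewrite -dotp_norm dotp_suml; apply: eq_bigr => g _.
  rewrite dotp_sumr; apply: eq_bigr => g' _.
  by rewrite dotpZl dotpZr -proj_kernelE mulrA.
apply: le_trans (dotp_Cauchy_Schwarz _ _) _; rewrite ler_wpM2r ?exprn_ge0//.
rewrite (_ : sqn S h = of_real k (\sum_(g <- S) modulus (h g) ^+ 2)).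
  by rewrite -dotp_norm dotpxx -rmorphD ler_of_real.
by rewrite rmorph_sum; apply: eq_bigr => g _; rewrite rmorphXn/= modulusE.
Qed.

(** As [n] grows, these lists exhaust all sites but [e], which is kept last and never revealed. *)
Definition initial (e : E) (n : nat) : seq E :=
  [seq x <- pmap pickle_inv (iota 0 n) | x != e].

Lemma mem_initial e n x : (x \in initial e n) = (x != e) && (choice.pickle x < n)%N.
Proof.
rewrite mem_filter; congr (_ && _); apply/idP/idP.
  rewrite mem_pmap => /mapP[m]; rewrite mem_iota add0n => mn.
  by have := @pickle_invK E m; case: pickle_inv => //= y ym [->]; rewrite ym.
move=> xn; rewrite mem_pmap; apply/mapP; exists (choice.pickle x).
  by rewrite mem_iota.
by rewrite pickleK_inv.
Qed.

Lemma uniq_initial e n : uniq (rcons (initial e n) e).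
Proof.
rewrite rcons_uniq mem_initial eqxx/= filter_uniq//.
by apply: (pmap_uniq (@pickle_invK E)); exact: iota_uniq.
Qed.

(** The patterns [b] on [S] for which [mass_observed_vacant] bounds the vacancy of [e]; the last
    clause says that [h] has mass at most [c] off [S] and [e]. *)
Definition forcing (e : E) (c : R) (S : seq E) (b : seq bool) : bool :=
  `[< exists h : V, [/\ H h, h e = 1,
      (forall p, p \in zip S b -> p.2 -> h p.1 = 0) &
      l2norm h ^+ 2 <= \sum_(g <- rcons S e) modulus (h g) ^+ 2 + c] >].

Definition forced_vacant e c n : set (borel_powerset E) :=
  observed (initial e n) (forcing e c (initial e n)) `&` ~` occupied e.

Lemma measurable_forced_vacant e c n : measurable (forced_vacant e c n).
Proof. by apply: measurableI; [exact: measurable_observed|exact: measurable_vacant]. Qed.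

Lemma forced_vacant_le e c n : 0 <= c -> (P (forced_vacant e c n) <= c%:E)%E.
Proof.
move=> c0; have kc0 : 0 <= of_real k c by rewrite -(rmorph0 (of_real k)) ler_of_real.
have := @mass_observed_vacant R k E P (initial e n) e (of_real k c) setT
  (forcing e c (initial e n)) proj_kernel.
rewrite setTI {2}/mass probability_setT/= rmorph1 mulr1.
rewrite ler_of_real => /(_ kc0 (@measurableT _ _) proj_kernel_hermitian
  (uniq_initial e n)
  (@local_law_proj_kernel _)) le1.
rewrite -[P _]fineK ?fin_num_measure//; last exact: measurable_forced_vacant.
rewrite lee_fin; apply: le1 => b _ /asboolP[h [Hh he hb hc]].
by exists h; split=> //; exact: dominated_proj_kernel.
Qed.

Definition missing e : set (borel_powerset E) :=
  [set B | ~~ B e /\ exists h : V, [/\ H h, h e = 1 & forall f, B f -> h f = 0]].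

(** All but [c] of the mass of a witness [h] sits on a finite set [A], and the same [h] serves for
    [forcing] as soon as the revealed sites together with [e] contain [A]. *)
Lemma missing_sub e c : 0 < c -> missing e `<=` eventually_all (forced_vacant e c).
Proof.
move=> c0 B [Be [h [Hh he hB]]].
have [A hA] : exists A : {fset E}, l2norm h ^+ 2 - c < \sum_(e <- A) modulus (h e) ^+ 2.
  by apply: sqsum_partial_gt; rewrite ltrBlDr ltrDl.
(* From this index on, every site of [A] has a code below [m]; the successor accounts for the strict
   bound in [mem_initial]. *)
exists (\max_(x <- A) (choice.pickle x).+1)%N => // m /= Am; split; last exact/negP.
apply/asboolP; exists h; split=> //.
  by move=> p; rewrite -[X in zip X]map_id zip_map => /mapP[x _ ->] /= /hB.
apply: le_trans (_ : _ <= \sum_(g <- A) modulus (h g) ^+ 2 + c) _.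
  by rewrite -lerBlDr ltW.
rewrite lerD2r; apply: le_sum_subset => [g|||x xA];
  rewrite ?sqr_ge0 ?fset_uniq ?uniq_initial//.
rewrite mem_rcons inE mem_initial; case: eqVneq => //= _.
by apply: leq_trans Am; exact: leq_bigmax_seq.
Qed.

(** [missing e] is a union over a possibly uncountable set of [h], so it is covered by measurable
    events of probability at most [1 / (n + 1)] rather than measured itself. *)
Lemma negligible_missing e : P.-negligible (missing e).
Proof.
pose N n := eventually_all (forced_vacant e n.+1%:R^-1).
have mN n : measurable (N n).
  by apply: measurable_eventually_all => m; exact: measurable_forced_vacant.
exists (\bigcap_n N n); split; first exact: bigcapT_measurable.
  apply/eqP; rewrite eq_le measure_ge0 andbT; apply/lee_addgt0Pr => c c0; rewrite add0e.
  have /ltr_add_invr[n] : 0 < c by []. rewrite add0r => nc.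
  apply: (@le_trans _ _ (P (N n))).
    by apply: le_measure; rewrite ?inE//; [exact: bigcapT_measurable|exact: bigcap_inf].
  apply: (@le_trans _ _ (n.+1%:R^-1)%:E); last by rewrite lee_fin ltW.
  apply: measure_eventually_all_le => m; first exact: measurable_forced_vacant.
  by apply: forced_vacant_le; rewrite invr_ge0.
by move=> B mB n _; apply: missing_sub => //; rewrite invr_gt0.
Qed.

Lemma total_of_not_missing (B : borel_powerset E) : (forall e, ~ missing e B) ->
  closure (lspan [set orth_proj H (delta e) | e in [set e | B e]]) = H.
Proof.
move=> nB; apply: closure_lspan_total => //.
  by move=> _ [e _ <-]; exact: orth_proj_in.
move=> h Hh hS; apply: val_inj; apply/funext => e /=; apply: contrapT => /eqP he.
have hB f : B f -> h f = 0.
  move=> Bf; rewrite -dotp_std -(dotp_orth_projr H_submod H_closed)//.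
  by apply: hS; exists f.
apply: (nB e); split; first by apply/negP => /hB /eqP; apply/negP.
exists ((h e)^-1 *: h); split; first exact: submodZ.
- by rewrite ell2ZE mulVf.
- by move=> f /hB hf; rewrite ell2ZE hf mulr0.
Qed.

End kernel.

Theorem theorem7p11 (R : realType) (k : scalar_kind) (E : countType)
    (H : set (ell2 R k E)) (P : probability (borel_powerset E) R)
    (H_submod : submod_closed [in H]) (H_closed : closed H)
    (P_law : determinantal_law H P) :
  {ae P, forall B : borel_powerset E,
    closure (lspan [set orth_proj H (std_basis R k e) | e in [set e | B e]]) = H}.
Proof.
(* Countability of [E] enters here: sites are enumerated by their codes, and a number that codes no
   site contributes the empty event. *)
pose N n := if @choice.unpickle E n is Some e then missing H e else set0.
apply: (@negligibleS _ _ _ P (\bigcup_n N n)).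
  move=> B /= nB; apply: contrapT => BN; apply: nB.
  apply: total_of_not_missing => // e Be; apply: BN.
  by exists (choice.pickle e) => //; rewrite /N choice.pickleK.
apply: negligible_bigcup => n; rewrite /N; case: choice.unpickle => [e|].
  exact: negligible_missing.
exact: negligible_set0.
Qed.
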